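(* Let $R$ be a ring and $n\geq 1$ an integer. The following statements are equivalent: (1) $R$ is a left localizable ring with $|\max\mathrm{Den}_l(R)|=n$; (2) the classical left quotient ring $Q_{l,cl}(R)$ exists and $Q_{l,cl}(R)\cong R_1\times\cdots\times R_n$ where $R_1,\ldots,R_n$ are division rings; (3) $R$ is a semiprime left Goldie ring with $\mathrm{udim}(R)=|\mathrm{Min}(R)|=n$, where $\mathrm{Min}(R)$ is the set of minimal prime ideals of $R$; (4) $Q_l(R)\cong R_1\times\cdots\times R_n$ where $R_1,\ldots,R_n$ are division rings.
   Context: All rings are associative with $1$. A multiplicative subset $S$ of $R$ ($1\in S$, $0\notin S$, closed under multiplication) is a left Ore set if $Sr\cap Rs\neq\emptyset$ for all $r\in R$, $s\in S$; for it, $\mathrm{ass}(S):=\{r\in R: sr=0\text{ for some } s\in S\}$. A left Ore set $S$ is a left denominator set if $rs=0$ ($r\in R$, $s\in S$) implies $tr=0$ for some $t\in S$. $\mathrm{Den}_l(R)$ is the set of left denominator sets, $S^{-1}R$ the left localization, and $\max\mathrm{Den}_l(R)$ the set of maximal elements of $(\mathrm{Den}_l(R),\subseteq)$. A ring $R$ is left localizable if every nonzero $r\in R$ lies in some $S\in\mathrm{Den}_l(R)$. $\mathcal{C}_R$ is the set of (left and right) regular elements of $R$; $Q_{l,cl}(R):=\mathcal{C}_R^{-1}R$ is the classical left quotient ring (existing when $\mathcal{C}_R$ is a left Ore set). $S_0(R)$ denotes the largest left Ore set of $R$ consisting of regular elements (it exists and is a left denominator set), and $Q_l(R):=S_0(R)^{-1}R$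 is the largest left quotient ring of $R$. $\mathrm{udim}(R)$ is the uniform (Goldie) dimension of $R$ as a left $R$-module. *)

(* Defs.v *)
From HB Require Import structures.
From mathcomp Require Import all_boot all_order all_algebra.
Set Implicit Arguments. Unset Strict Implicit. Unset Printing Implicit Defensive.
Import GRing.Theory.
Local Open Scope ring_scope.

Definition subset_of {T : Type} (A B : T -> Prop) := forall x, A x -> B x.
Definition same_set {T : Type} (A B : T -> Prop) := forall x, A x <-> B x.

Definition card_sets_eq {T : Type} (P : (T -> Prop) -> Prop) (n : nat) :=
  exists F : 'I_n -> (T -> Prop),
    (forall i, P (F i)) /\
    (forall i j, same_set (F i) (F j) -> i = j) /\
    (forall S, P S -> exists i, same_set S (F i)).

Section RingDefs.
Variable R : pzRingType.

Definition mult_subset (S : R -> Prop) :=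
  S 1 /\ ~ S 0 /\ forall a b, S a -> S b -> S (a * b).

Definition left_ore (S : R -> Prop) :=
  mult_subset S /\ forall r s, S s -> exists s' r', S s' /\ s' * r = r' * s.

Definition ass (S : R -> Prop) (r : R) := exists s, S s /\ s * r = 0.

Definition left_den (S : R -> Prop) :=
  left_ore S /\ forall r s, S s -> r * s = 0 -> exists t, S t /\ t * r = 0.

Definition max_left_den (S : R -> Prop) :=
  left_den S /\ forall T, left_den T -> subset_of S T -> subset_of T S.

Definition left_localizable :=
  forall r : R, r <> 0 -> exists S, left_den S /\ S r.

Definition regular (x : R) :=
  (forall y, x * y = 0 -> y = 0) /\ (forall y, y * x = 0 -> y = 0).

Definition is_left_localization (S : R -> Prop) (Q : pzRingType)
    (f : {rmorphism R -> Q}) :=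
  (forall s, S s -> exists u, f s * u = 1 /\ u * f s = 1) /\
  (forall q, exists s r, S s /\ f s * q = f r) /\
  (forall r, f r = 0 <-> ass S r).

Definition is_S0 (S : R -> Prop) :=
  left_ore S /\ subset_of S regular /\
  forall T, left_ore T -> subset_of T regular -> subset_of T S.

Definition ideal (I : R -> Prop) :=
  I 0 /\ (forall x y, I x -> I y -> I (x - y)) /\
  (forall r x, I x -> I (r * x)) /\ (forall r x, I x -> I (x * r)).

Definition prime_ideal (P : R -> Prop) :=
  ideal P /\ ~ P 1 /\
  forall I J, ideal I -> ideal J ->
    (forall i j, I i -> J j -> P (i * j)) -> subset_of I P \/ subset_of J P.

Definition minimal_prime (P : R -> Prop) :=
  prime_ideal P /\ forall P', prime_ideal P' -> subset_of P' P -> subset_of P P'.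

Definition semiprime_ring :=
  forall I, ideal I ->
    (exists k : nat, forall s : seq R, size s = k.+1 ->
        (forall x, x \in s -> I x) -> \prod_(x <- s) x = 0) ->
    forall x, I x -> x = 0.

Definition left_ideal (L : R -> Prop) :=
  L 0 /\ (forall x y, L x -> L y -> L (x - y)) /\ (forall r x, L x -> L (r * x)).

Definition independent_left_ideals (m : nat) (L : 'I_m -> (R -> Prop)) :=
  forall x : 'I_m -> R, (forall i, L i (x i)) -> \sum_i x i = 0 -> forall i, x i = 0.

Definition udim_eq (n : nat) :=
  (exists L : 'I_n -> (R -> Prop),
     (forall i, left_ideal (L i) /\ exists x, L i x /\ x <> 0) /\
     independent_left_ideals L) /\
  ~ (exists L : 'I_n.+1 -> (R -> Prop),
     (forall i, left_ideal (L i) /\ exists x, L i x /\ x <> 0) /\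
     independent_left_ideals L).

Definition finite_udim := exists n, udim_eq n.

Definition lann (X : R -> Prop) (r : R) := forall x, X x -> r * x = 0.

Definition acc_left_annihilators :=
  forall X : nat -> (R -> Prop),
    (forall k, subset_of (lann (X k)) (lann (X k.+1))) ->
    exists N, forall k, (N <= k)%N -> subset_of (lann (X k)) (lann (X N)).

Definition left_goldie := acc_left_annihilators /\ finite_udim.
End RingDefs.

Definition division_ring (D : nzRingType) :=
  forall x : D, x <> 0 -> exists y, x * y = 1 /\ y * x = 1.

(* Q is isomorphic to a direct product D_1 x ... x D_n of division rings:
   the family of ring morphisms phi_i : Q -> D_i induces a bijection
   Q -> prod_i D_i (which is then a ring isomorphism onto the product). *)
Definition iso_prod_division_rings (Q : pzRingType) (n : nat) :=
  exists D : 'I_n -> nzRingType,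
    (forall i, division_ring (D i)) /\
    exists phi : forall i, {rmorphism Q -> D i},
      (forall q1 q2, (forall i, phi i q1 = phi i q2) -> q1 = q2) /\
      (forall d : forall i, D i, exists q, forall i, phi i q = d i).

(* Main.v *)
Require Import Defs.
From HB Require Import structures.
From mathcomp Require Import all_boot all_order all_algebra.
From mathcomp Require Import boolp.
From mathcomp Require classical_sets.
Set Implicit Arguments. Unset Strict Implicit. Unset Printing Implicit Defensive.
Import GRing.Theory.
Local Open Scope ring_scope.

(** All four conditions are equivalent to an elementwise one: there are n
completely prime ideals K_1, ..., K_n with zero intersection, none of them
containing the intersection of the others, such that the complement of each K_i
satisfies the left Ore condition modulo K_i. The maximal left denominator sets
are then the complements of the K_i, the minimal primes are the K_i, and the
localizations at the complements are division rings D_i, into whose product R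
embeds with the regular elements as denominators.

To find the K_i, consider families of nonzero elements a_1, ..., a_m with
a_i R a_j = 0 for i <> j. Their size is bounded: in (1) because no left
denominator set contains two of them (and R is reduced), in (3) because they
generate an independent family of left ideals. For a family of maximal size,
K_i = {x | a_i R x = 0} is a prime ideal and the K_i have zero intersection. In
(3) the K_i are the minimal primes, so m = udim R and each intersection of the
K_j, j <> i, is a uniform left ideal; the ascending chain condition on left
annihilators makes it nonsingular, hence a domain. *)

(** * Left localization at a denominator set *)

Section Localization.
Variables (R : pzRingType) (S : R -> Prop) (S_den : left_den S).

Let S1 : S 1. Proof. by case: S_den => -[[]]. Qed.
Let SM a b : S a -> S b -> S (a * b).
Proof. by case: S_den => -[[_ [_ h]]] _ _; exact: h. Qed.
Let S_ore r s : S s -> exists s' r', S s' /\ s' * r = r' * s.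
Proof. by case: S_den => -[_ h] _; exact: h. Qed.
Let S_rev r s : S s -> r * s = 0 -> ass S r.
Proof. by case: S_den => _; exact. Qed.

Definition submodule2 (G : R -> R -> Prop) :=
  (forall x y x' y', G x y -> G x' y' -> G (x - x') (y - y')) /\
  (forall r x y, G x y -> G (r * x) (r * y)).

(** An element of R becomes 0 in the localization exactly when it lies in [ass S], so values are
    only determined modulo [ass S]. *)
Definition single_valued (G : R -> R -> Prop) := forall y, G 0 y -> ass S y.

Definition densely_defined (G : R -> R -> Prop) := exists s y, S s /\ G s y.

(** Elements of S become invertible, so t x q = t y must force x q = y; this makes the graph of a
    fraction unique. *)
Definition saturated (G : R -> R -> Prop) :=
  forall t x y, S t -> G (t * x) (t * y) -> G x y.

(* An element q of the localization is encoded by its graph, the set of all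
   (x, y) in R x R with x q = y. Equal fractions then have equal graphs, so no
   quotient is needed. *)
Record fraction := Fraction {
  graph :> R -> R -> Prop;
  graph_submodule : submodule2 graph;
  graph_single : single_valued graph;
  graph_dense : densely_defined graph;
  graph_saturated : saturated graph }.

Implicit Types (p q : fraction) (r s t x y : R).

Lemma graphB p x y x' y' : p x y -> p x' y' -> p (x - x') (y - y').
Proof. by case: (graph_submodule p) => h _; exact: h. Qed.

Lemma graphM p r x y : p x y -> p (r * x) (r * y).
Proof. by case: (graph_submodule p) => _; apply. Qed.

Lemma ass_cancel t y : S t -> ass S (t * y) -> ass S y.
Proof. by move=> St [s [Ss e]]; exists (s * t); rewrite -mulrA e; split=> //; exact: SM. Qed.

Lemma graph_unique p x y z : p x y -> p x z -> ass S (y - z).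
Proof. by move=> py pz; apply: (@graph_single p); rewrite -(subrr x); exact: graphB. Qed.

Lemma graph_ass p x y z : p x y -> ass S (y - z) -> p x z.
Proof.
move=> pxy [s [Ss e]]; apply: (@graph_saturated p s) => //.
move: e; rewrite mulrBr => /subr0_eq <-; exact: graphM.
Qed.

(** By the Ore condition some t x equals r s. Both graphs send it to r y, which differs from t z by
    an element of [ass S]; saturation of q then cancels t. *)
Lemma fraction_eq_sub p q s y : S s -> p s y -> q s y ->
  forall x z, p x z -> q x z.
Proof.
move=> Ss ps qs x z pxz; have [t [r [St e]]] := S_ore x Ss.
apply: (@graph_saturated q t) => //; apply: (@graph_ass _ _ (r * y)).
  by rewrite e; exact: graphM.
by apply: (@graph_unique p (t * x)); [rewrite e|]; exact: graphM.
Qed.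

(** The ring axioms are all verified this way, by exhibiting a common point of two graphs whose
    first coordinate lies in S. *)
Lemma fraction_ext p q s y : S s -> p s y -> q s y -> p = q.
Proof.
move=> Ss ps qs; have epq : graph p = graph q.
  apply/funext => x; apply/funext => z; apply/propext.
  by split; [exact: (fraction_eq_sub Ss ps qs)|exact: (fraction_eq_sub Ss qs ps)].
case: p q epq {ps qs} => [g1 a1 b1 c1 d1] [g2 a2 b2 c2 d2] /= e.
by subst g2; congr Fraction; exact: Prop_irrelevance.
Qed.

Lemma graph_dom p x : exists t y, S t /\ p (t * x) y.
Proof.
have [s [y [Ss ps]]] := graph_dense p; have [t [r [St e]]] := S_ore x Ss.
by exists t, (r * y); split=> //; rewrite e; exact: graphM.
Qed.

Section Saturation.
Variable H : R -> R -> Prop.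
Hypotheses (H_mod : submodule2 H) (H_sv : single_valued H) (H_dd : densely_defined H).

(** Sums and composites of graphs need not be saturated; this closure restores saturation. *)
Let sat x y := exists t, S t /\ H (t * x) (t * y).

Let HM r x y : H x y -> H (r * x) (r * y). Proof. by case: H_mod => _; exact. Qed.

Fact sat_submodule : submodule2 sat.
Proof.
split=> [x y x' y' [t [St h]] [t' [St' h']]|r x y [t [St h]]].
  have [u [r [Su e]]] := S_ore t St'; exists (u * t); split; first exact: SM.
  rewrite !mulrBr; case: (H_mod) => + _; apply; first by rewrite -!mulrA; exact: HM.
  by rewrite e -!mulrA; exact: HM.
have [u [r' [Su e]]] := S_ore r St; exists u; split=> //.
by rewrite !mulrA e -!mulrA; exact: HM.
Qed.

Fact sat_single : single_valued sat.
Proof. by move=> y [t [St]]; rewrite mulr0 => /H_sv; exact: ass_cancel. Qed.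

Fact sat_dense : densely_defined sat.
Proof. by case: H_dd => s [y [Ss h]]; exists s, y; split=> //; exists 1; rewrite !mul1r. Qed.

Fact sat_saturated : saturated sat.
Proof.
by move=> t x y St [u [Su h]]; exists (u * t); rewrite -!mulrA; split=> //; exact: SM.
Qed.

Definition saturate := Fraction sat_submodule sat_single sat_dense sat_saturated.

Lemma saturateP x y : H x y -> saturate x y.
Proof. by move=> h; exists 1; rewrite !mul1r. Qed.

End Saturation.

Section FractionOf.
Variables (s r : R) (Ss : S s).

(** The left multiples of the pair (s, r) generate the graph of the fraction s^-1 r. *)
Let H x y := exists a, x = a * s /\ y = a * r.

Fact fraction_of_submodule : submodule2 H.
Proof.
split=> [_ _ _ _ [a [-> ->]] [b [-> ->]]|c _ _ [a [-> ->]]].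
  by exists (a - b); rewrite !mulrBl.
by exists (c * a); rewrite !mulrA.
Qed.

(** Reversibility of S enters here: a s = 0 gives t a = 0 for some t in S, hence t a r = 0. *)
Fact fraction_of_single : single_valued H.
Proof.
move=> _ [a [/esym/(S_rev Ss)[t [St e]] ->]].
by exists t; rewrite mulrA e mul0r.
Qed.

Fact fraction_of_dense : densely_defined H.
Proof. by exists s, r; split=> //; exists 1; rewrite !mul1r. Qed.

Definition fraction_of :=
  saturate fraction_of_submodule fraction_of_single fraction_of_dense.

Lemma fraction_ofP a : fraction_of (a * s) (a * r).
Proof. by apply: saturateP; exists a. Qed.

End FractionOf.

(* Only the ring structure, not the carrier, depends on the proof [S_den]. *)
Definition localization : Type := let _ := S_den in fraction.

Definition frac_inj r : localization := fraction_of r S1.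

Lemma frac_injP r x y : y = x * r -> frac_inj r x y.
Proof. by move=> ->; have := fraction_ofP r S1 x; rewrite mulr1. Qed.

Section Add.
Variables p q : fraction.

Let H x z := exists y y', p x y /\ q x y' /\ z = y + y'.

Fact frac_add_submodule : submodule2 H.
Proof.
split=> [x _ x' _ [a [b [pa [qb ->]]]] [c [d [pc [qd ->]]]]|r x _ [a [b [pa [qb ->]]]]].
  by exists (a - c), (b - d); rewrite opprD addrACA; do !split; exact: graphB.
by exists (r * a), (r * b); rewrite mulrDr; do !split; exact: graphM.
Qed.

Fact frac_add_single : single_valued H.
Proof.
move=> _ [a [b [pa [qb ->]]]].
have [s [Ss e]] := graph_single pa.
have q0 : q 0 (s * b) by rewrite -(mulr0 s); exact: graphM.
have [t [St e']] := graph_single q0.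
exists (t * s); split; first exact: SM.
by rewrite -mulrA mulrDr e add0r.
Qed.

Fact frac_add_dense : densely_defined H.
Proof.
have [s [y [Ss ps]]] := graph_dense p; have [t [z [St qt]]] := graph_dom q s.
exists (t * s), (t * y + z); split; first exact: SM.
by exists (t * y), z; do !split=> //; exact: graphM.
Qed.

Definition frac_add := saturate frac_add_submodule frac_add_single frac_add_dense.

Lemma frac_addP x y z : p x y -> q x z -> frac_add x (y + z).
Proof. by move=> ? ?; apply: saturateP; exists y, z. Qed.

End Add.

Section Opp.
Variable p : fraction.

Let H x y := p x (- y).

Fact frac_opp_submodule : submodule2 H.
Proof.
rewrite /H; split=> [x y x' y' h h'|r x y h]; last by rewrite -mulrN; exact: graphM.
by rewrite opprD; exact: graphB.
Qed.

Fact frac_opp_single : single_valued H.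
Proof.
by move=> y /graph_single[s [Ss]]; rewrite mulrN => /eqP; rewrite oppr_eq0 => /eqP; exists s.
Qed.

Fact frac_opp_dense : densely_defined H.
Proof. by have [s [y [Ss ps]]] := graph_dense p; exists s, (- y); rewrite /H opprK. Qed.

Definition frac_opp := saturate frac_opp_submodule frac_opp_single frac_opp_dense.

Lemma frac_oppP x y : p x y -> frac_opp x (- y).
Proof. by move=> h; apply: saturateP; rewrite /H opprK. Qed.

End Opp.

Section Mul.
Variables p q : fraction.

(** Graphs encode right multiplication by a fraction, so the product p q is the composite that
    applies p first. *)
Let H x z := exists y, p x y /\ q y z.

Fact frac_mul_submodule : submodule2 H.
Proof.
split=> [x y x' y' [a [pa qa]] [b [pb qb]]|r x y [a [pa qa]]].
  by exists (a - b); split; exact: graphB.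
by exists (r * a); split; exact: graphM.
Qed.

Fact frac_mul_single : single_valued H.
Proof.
move=> z [y [/graph_single[s [Ss e]] /(graphM s)]].
by rewrite e => /graph_single; exact: ass_cancel.
Qed.

Fact frac_mul_dense : densely_defined H.
Proof.
have [s [y [Ss ps]]] := graph_dense p; have [t [z [St qt]]] := graph_dom q y.
exists (t * s), z; split; first exact: SM.
by exists (t * y); split=> //; exact: graphM.
Qed.

Definition frac_mul := saturate frac_mul_submodule frac_mul_single frac_mul_dense.

Lemma frac_mulP x y z : p x y -> q y z -> frac_mul x z.
Proof. by move=> ? ?; apply: saturateP; exists y. Qed.

End Mul.

Lemma common_dom2 p q x : exists s y z, S s /\ p (s * x) y /\ q (s * x) z.
Proof.
have [s [y [Ss ps]]] := graph_dom p x; have [t [z [St qt]]] := graph_dom q (s * x).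
exists (t * s), (t * y), z; rewrite -mulrA; split; first exact: SM.
by split=> //; exact: graphM.
Qed.

Fact frac_addA : associative frac_add.
Proof.
move=> p q u; have [s [y [z [Ss [ps qs]]]]] := common_dom2 p q 1.
have [t [w [St ut]]] := graph_dom u (s * 1).
apply: (@fraction_ext _ _ (t * (s * 1)) (t * y + (t * z + w))).
- by rewrite mulr1; exact: SM.
- by do !apply: frac_addP => //; exact: graphM.
- by rewrite addrA; do !apply: frac_addP => //; exact: graphM.
Qed.

Fact frac_addC : commutative frac_add.
Proof.
move=> p q; have [s [y [z [Ss [ps qs]]]]] := common_dom2 p q 1.
apply: (@fraction_ext _ _ (s * 1) (y + z)); first by rewrite mulr1.
  exact: frac_addP.
by rewrite addrC; exact: frac_addP.
Qed.

Fact frac_add0 : left_id (frac_inj 0) frac_add.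
Proof.
move=> p; have [s [y [Ss ps]]] := graph_dense p; apply: (fraction_ext Ss _ ps).
by rewrite -[y]add0r; apply: frac_addP => //; apply: frac_injP; rewrite mulr0.
Qed.

Fact frac_addN : left_inverse (frac_inj 0) frac_opp frac_add.
Proof.
move=> p; have [s [y [Ss ps]]] := graph_dense p.
apply: (@fraction_ext _ _ s 0) => //.
  by rewrite -(addNr y); apply: frac_addP => //; exact: frac_oppP.
by apply: frac_injP; rewrite mulr0.
Qed.

Fact frac_mulA : associative frac_mul.
Proof.
move=> p q u; have [s [y [Ss ps]]] := graph_dense p.
have [t [z [St qt]]] := graph_dom q y; have [v [w [Sv uv]]] := graph_dom u z.
apply: (@fraction_ext _ _ (v * (t * s)) w).
- by do !apply: SM.
- apply: (@frac_mulP _ _ _ (v * (t * y))); first by do !apply: graphM.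
  by apply: (@frac_mulP _ _ _ (v * z)) => //; exact: graphM.
- apply: (@frac_mulP _ _ _ (v * z)) => //.
  by apply: (@frac_mulP _ _ _ (v * (t * y))); do !apply: graphM.
Qed.

Fact frac_mul1l : left_id (frac_inj 1) frac_mul.
Proof.
move=> p; have [s [y [Ss ps]]] := graph_dense p; apply: (fraction_ext Ss _ ps).
by apply: (@frac_mulP _ _ _ s) => //; apply: frac_injP; rewrite mulr1.
Qed.

Fact frac_mul1r : right_id (frac_inj 1) frac_mul.
Proof.
move=> p; have [s [y [Ss ps]]] := graph_dense p; apply: (fraction_ext Ss _ ps).
by apply: (@frac_mulP _ _ _ y) => //; apply: frac_injP; rewrite mulr1.
Qed.

Fact frac_mulDl : left_distributive frac_mul frac_add.
Proof.
move=> p q u; have [s [y [z [Ss [ps qs]]]]] := common_dom2 p q 1.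
(* First t moves y, then v moves t z, into the domain of u, so that one multiple of s serves for
   both products. *)
have [t [w [St ut]]] := graph_dom u y; have [v [w' [Sv uv]]] := graph_dom u (t * z).
apply: (@fraction_ext _ _ (v * (t * (s * 1))) (v * w + w')).
- by rewrite mulr1; do !apply: SM.
- apply: (@frac_mulP _ _ _ (v * (t * (y + z)))).
    by do 2!apply: graphM; exact: frac_addP.
  rewrite !mulrDr; have := graphB (graphM v ut) (graphM (- 1) uv).
  by rewrite !mulN1r !opprK.
- apply: frac_addP.
    by apply: (@frac_mulP _ _ _ (v * (t * y))); do !apply: graphM.
  by apply: (@frac_mulP _ _ _ (v * (t * z))) => //; do !apply: graphM.
Qed.

Fact frac_mulDr : right_distributive frac_mul frac_add.
Proof.
move=> p q u; have [s [y [Ss ps]]] := graph_dense p.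
have [t [z [w [St [qt ut]]]]] := common_dom2 q u y.
apply: (@fraction_ext _ _ (t * s) (z + w)); first exact: SM.
  by apply: (@frac_mulP _ _ _ (t * y)); [exact: graphM|exact: frac_addP].
by apply: frac_addP; apply: (@frac_mulP _ _ _ (t * y)) => //; exact: graphM.
Qed.

HB.instance Definition _ := gen_eqMixin localization.
HB.instance Definition _ := gen_choiceMixin localization.
HB.instance Definition _ := GRing.isPzRing.Build localization
  frac_addA frac_addC frac_add0 frac_addN frac_mulA frac_mul1l frac_mul1r
  frac_mulDl frac_mulDr.

Fact frac_inj_is_zmod_morphism : zmod_morphism frac_inj.
Proof.
move=> r r'; apply: (@fraction_ext _ _ 1 (r - r')) => //.
  by apply: frac_injP; rewrite mul1r.
apply: frac_addP; first by apply: frac_injP; rewrite mul1r.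
by apply: frac_oppP; apply: frac_injP; rewrite mul1r.
Qed.

Fact frac_inj_is_monoid_morphism : monoid_morphism frac_inj.
Proof.
split=> // r r'; apply: (@fraction_ext _ _ 1 (r * r')) => //.
  by apply: frac_injP; rewrite mul1r.
by apply: (@frac_mulP _ _ _ r); apply: frac_injP; rewrite ?mul1r.
Qed.

HB.instance Definition _ :=
  GRing.isZmodMorphism.Build R localization frac_inj frac_inj_is_zmod_morphism.
HB.instance Definition _ :=
  GRing.isMonoidMorphism.Build R localization frac_inj frac_inj_is_monoid_morphism.

Lemma frac_inj_localization : is_left_localization S frac_inj.
Proof.
split; [|split].
- move=> s Ss; exists (fraction_of 1 Ss).
  have h1 a : fraction_of 1 Ss (a * s) a by rewrite -{2}[a]mulr1; exact: fraction_ofP.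
  split.
    apply: (@fraction_ext _ _ 1 1) => //; last by apply: frac_injP; rewrite mulr1.
    by apply: (@frac_mulP _ _ _ (1 * s)) => //; exact: frac_injP.
  apply: (@fraction_ext _ _ s s) => //; last by apply: frac_injP; rewrite mulr1.
  apply: (@frac_mulP _ _ _ 1); first by have := h1 1; rewrite mul1r.
  by apply: frac_injP; rewrite mul1r.
- move=> q; have [s [r [Ss qs]]] := graph_dense q; exists s, r; split=> //.
  apply: (@fraction_ext _ _ 1 r) => //; last by apply: frac_injP; rewrite mul1r.
  by apply: (@frac_mulP _ _ _ s) => //; apply: frac_injP; rewrite mul1r.
- move=> r; split=> [e|[s [Ss e]]].
    have h : frac_inj r 1 0 by rewrite e; apply: frac_injP; rewrite mulr0.
    by have := graph_unique (frac_injP erefl) h; rewrite mul1r subr0.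
  apply: (@fraction_ext _ _ s 0) => //; first exact: frac_injP.
  by apply: frac_injP; rewrite mulr0.
Qed.

End Localization.

Lemma localization_exists (R : pzRingType) (S : R -> Prop) : left_den S ->
  exists (Q : pzRingType) (f : {rmorphism R -> Q}), is_left_localization S f.
Proof.
by move=> S_den; exists (localization S_den), (frac_inj S_den); exact: frac_inj_localization.
Qed.

(** * Ore decompositions *)

(** Serves to identify the size of a decomposition that has been found with the prescribed n. *)
Lemma card_sets_eq_unique (T : Type) (P : (T -> Prop) -> Prop) (m n : nat) :
  card_sets_eq P m -> card_sets_eq P n -> m = n.
Proof.
wlog suff le_mn : m n / card_sets_eq P m -> card_sets_eq P n -> (m <= n)%N.
  by move=> hm hn; apply/eqP; rewrite eqn_leq !le_mn.
move=> [F [PF [F_inj _]]] [G [_ [_ G_surj]]].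
have [g gP] := choice (fun i => G_surj _ (PF i)).
rewrite -(card_ord m) -(card_ord n); apply: (leq_card g) => i j gij.
by apply: F_inj => x; rewrite (gP i) (gP j) gij.
Qed.

Section Primes.
Variable R : pzRingType.
Implicit Types (P I J : R -> Prop) (r s x y : R).

Definition elementwise_prime P :=
  [/\ ideal P, ~ P 1 & forall x y, (forall r, P (x * r * y)) -> P x \/ P y].

Definition completely_prime P :=
  [/\ ideal P, ~ P 1 & forall x y, P (x * y) -> P x \/ P y].

Lemma ideal_zero I : ideal I -> I 0. Proof. by case. Qed.
Lemma ideal_sub I x y : ideal I -> I x -> I y -> I (x - y).
Proof. by case=> _ [h _]; exact: h. Qed.
Lemma ideal_mull I r x : ideal I -> I x -> I (r * x).
Proof. by case=> _ [_ [h _]]; exact: h. Qed.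
Lemma ideal_mulr I r x : ideal I -> I x -> I (x * r).
Proof. by case=> _ [_ [_ h]]; exact: h. Qed.

Lemma completely_prime_elementwise P : completely_prime P -> elementwise_prime P.
Proof. by case=> ? ? h; split=> // x y /(_ 1); rewrite mulr1; exact: h. Qed.

Lemma elementwise_prime_prime P : elementwise_prime P -> prime_ideal P.
Proof.
case=> idP P1 hP; split=> //; split=> // I J idI idJ IJP.
have [|/existsNP[i /not_implyP[Ii nPi]]] := EM (subset_of I P); first by left.
right=> j Jj; have [r||] // := hP i j.
by apply: IJP => //; exact: ideal_mulr.
Qed.

Lemma prime_elementwise_prime P : prime_ideal P -> elementwise_prime P.
Proof.
case=> idP [P1 hP]; split=> // x y xPy.
(* I contains x, J contains y and I J lies in P. Defining both as annihilators modulo P avoids the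
   finite sums that describe generated ideals. *)
pose I z := forall r, P (z * r * y).
pose J z := forall w r, I w -> P (w * r * z).
have [|||IP|JP] := hP I J.
- split; first by move=> r; rewrite !mul0r; exact: ideal_zero.
  split; first by move=> z w hz hw r; rewrite !mulrBl; exact: ideal_sub.
  split=> a z hz r; last by rewrite -(mulrA z); exact: hz.
  by rewrite -!mulrA; apply: ideal_mull => //; rewrite mulrA.
- split; first by move=> w r _; rewrite mulr0; exact: ideal_zero.
  split; first by move=> z z' hz hz' w r hw; rewrite mulrBr; apply: ideal_sub; auto.
  split=> a z hz w r hw; last by rewrite mulrA; apply: ideal_mulr => //; exact: hz.
  by rewrite mulrA -(mulrA w); exact: hz.
- by move=> z w hz hw; rewrite -[z]mulr1; exact: hw.
- by left; exact: IP.
- by right; apply: JP => w r; exact.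
Qed.

Lemma separated_left_ideal n (K : 'I_n -> R -> Prop) i : (forall j, ideal (K j)) ->
  left_ideal (fun x => forall j, j != i -> K j x).
Proof.
move=> idK; split; first by move=> j _; exact: ideal_zero.
split=> [x y hx hy j ji|r x hx j ji]; first by apply: ideal_sub => //; auto.
by apply: ideal_mull => //; auto.
Qed.

(** If the sum vanishes, x_i is minus the sum of the other terms, which all lie in K_i. Since x_i
    also lies in every other K_j, it is 0. *)
Lemma separated_independent n (K : 'I_n -> R -> Prop) :
  (forall i, ideal (K i)) -> (forall x, (forall i, K i x) -> x = 0) ->
  independent_left_ideals (fun i x => forall j, j != i -> K j x).
Proof.
move=> idK K0 x Ux sx i; apply: K0 => j.
have [->|ji] := eqVneq j i; last exact: Ux.
move: sx; rewrite (bigD1 i) //= => /eqP.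
rewrite addr_eq0 => /eqP ->; rewrite -[X in K i X]sub0r.
apply: ideal_sub => //; first exact: ideal_zero.
elim/big_rec: _ => [|k y ki Ky]; first exact: ideal_zero.
rewrite -[y]opprK -(sub0r y); apply: ideal_sub => //; first by apply: Ux; rewrite eq_sym.
by apply: ideal_sub => //; exact: ideal_zero.
Qed.

(** Every prime P contains some K_i: otherwise primeness gives a product outside P with one factor
    from each K_i, but such a product lies in every K_i and is 0. The separating elements show that
    no K_i contains another. *)
Lemma card_minimal_primes n (K : 'I_n -> R -> Prop) :
  (forall i, elementwise_prime (K i)) ->
  (forall x, (forall i, K i x) -> x = 0) ->
  (forall i, exists c, ~ K i c /\ forall j, j != i -> K j c) ->
  card_sets_eq (@minimal_prime R) n.
Proof.
move=> K_prime K0 Kc.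
have K_incl i j : subset_of (K i) (K j) -> i = j.
  move=> sub; apply/eqP/negPn/negP => ij; have [c [nc cP]] := Kc j.
  by apply: nc; apply: sub; exact: cP.
have some_K P : prime_ideal P -> exists i, subset_of (K i) P.
  move=> P_prime; apply: contrapT => /forallNP noK.
  have [idP P1 hP] := prime_elementwise_prime P_prime.
  have key m : exists x, ~ P x /\ forall i : 'I_n, (i < m)%N -> K i x.
    elim: m => [|m [x [nPx Kx]]]; first by exists 1.
    have [mn|nm] := ltnP m n; last first.
      by exists x; split=> // i _; apply: Kx; exact: leq_trans nm.
    have /existsNP[p /not_implyP[Kp nPp]] := noK (Ordinal mn).
    have /existsNP[r nPr] : ~ forall r, P (x * r * p) by case/hP.
    exists (x * r * p); split=> // i; rewrite ltnS leq_eqVlt => /orP[/eqP im|im].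
      have -> : i = Ordinal mn by exact: val_inj.
      by apply: ideal_mull => //; case: (K_prime (Ordinal mn)).
    have [idK _ _] := K_prime i.
    by do 2!apply: ideal_mulr => //; exact: Kx.
  have [x [nPx Kx]] := key n; apply: nPx.
  by rewrite (K0 x) => [|i]; [exact: ideal_zero|exact: Kx].
exists K; split=> [i|].
  split=> [|P P_prime PK]; first exact: elementwise_prime_prime.
  have [j KjP] := some_K _ P_prime.
  have ji : j = i by apply: K_incl => x /KjP /PK.
  by rewrite -ji.
split=> [i j Kij|P [P_prime P_min]]; first by apply: K_incl => x /Kij.
have [i KiP] := some_K _ P_prime; exists i => x; split; last exact: KiP.
by apply: P_min => //; exact: elementwise_prime_prime.
Qed.

End Primes.

Section OreDecomposition.
Variables (R : pzRingType) (n : nat).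
Implicit Types (r s x y : R).

Definition ore_decomposition (K : 'I_n -> R -> Prop) :=
  [/\ forall i, completely_prime (K i),
      forall x, (forall i, K i x) -> x = 0,
      forall i, exists c, ~ K i c /\ forall j, j != i -> K j c &
      forall i r s, ~ K i s -> exists s' r', ~ K i s' /\ K i (s' * r - r' * s)].

Variable K : 'I_n -> R -> Prop.
Hypothesis K_dec : ore_decomposition K.

Let idK i : ideal (K i). Proof. by case: K_dec => /(_ i)[]. Qed.
Let K_1 i : ~ K i 1. Proof. by case: K_dec => /(_ i)[]. Qed.
Let KM i x y : K i (x * y) -> K i x \/ K i y.
Proof. by case: K_dec => /(_ i)[_ _ h] _ _ _; exact: h. Qed.
Let K_eq0 x : (forall i, K i x) -> x = 0. Proof. by case: K_dec => _ h _ _; exact: h. Qed.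
Let Kc i : exists c, ~ K i c /\ forall j, j != i -> K j c. Proof. by case: K_dec. Qed.
Let K_ore i r s : ~ K i s -> exists s' r', ~ K i s' /\ K i (s' * r - r' * s).
Proof. by case: K_dec => _ _ _ h; exact: h. Qed.

Let nKM i x y : ~ K i x -> ~ K i y -> ~ K i (x * y).
Proof. by move=> nx ny /KM[]. Qed.

(** The separating element c kills K_i from the left, because c x lies in every K_j when x is in
    K_i. Multiplication by c thus lifts the Ore condition modulo K_i to an equality in R. *)
Lemma decomposition_left_den i : left_den (fun x => ~ K i x).
Proof.
have [c [nc cP]] := Kc i.
have c0 x : K i x -> c * x = 0.
  move=> Kx; apply: K_eq0 => j; have [->|ji] := eqVneq j i; first exact: ideal_mull.
  by apply: ideal_mulr => //; exact: cP.
split; last first.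
  move=> r s ns e; exists c; split=> //; apply: c0.
  by have : K i (r * s) by [rewrite e; exact: ideal_zero]; case/KM.
split; first by do !split=> //; [apply; exact: ideal_zero|move=> a b; exact: nKM].
move=> r s ns; have [s' [r' [ns' e]]] := K_ore r ns.
exists (c * s'), (c * r'); split; first exact: nKM.
by apply: subr0_eq; rewrite -!mulrA -mulrBr; exact: c0.
Qed.

Lemma decomposition_ass i x : ass (fun x => ~ K i x) x <-> K i x.
Proof.
split=> [[s [ns e]]|Kx].
  by have : K i (s * x) by [rewrite e; exact: ideal_zero]; case/KM.
have [c [nc cP]] := Kc i; exists c; split=> //; apply: K_eq0 => j.
have [->|ji] := eqVneq j i; first exact: ideal_mull.
by apply: ideal_mulr => //; exact: cP.
Qed.

Lemma decomposition_localizable : left_localizable R.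
Proof.
move=> r r0; have /existsNP[i nKi] : ~ forall i, K i r by move/K_eq0.
by exists (fun x => ~ K i x); split=> //; exact: decomposition_left_den.
Qed.

(** If T met every K_i, a product of one element from each intersection would lie in T and in every
    K_i, so 0 would be in T. *)
Lemma left_den_sub_decomposition T : left_den T ->
  exists i, subset_of T (fun x => ~ K i x).
Proof.
move=> [[[T1 [T0 TM]] _] _]; apply: contrapT => /forallNP h.
have key m : exists x, T x /\ forall i : 'I_n, (i < m)%N -> K i x.
  elim: m => [|m [x [Tx Kx]]]; first by exists 1.
  have [mn|nm] := ltnP m n; last first.
    by exists x; split=> // i _; apply: Kx; exact: leq_trans nm.
  have /existsNP[t /not_implyP[Tt /contrapT Kt]] := h (Ordinal mn).
  exists (x * t); split=> [|i]; first exact: TM.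
  rewrite ltnS leq_eqVlt => /orP[/eqP im|im].
    have -> : i = Ordinal mn by exact: val_inj.
    exact: ideal_mull.
  by apply: ideal_mulr => //; exact: Kx.
have [x [Tx Kx]] := key n; apply: T0.
by rewrite -(K_eq0 (x := x)) // => i; exact: Kx.
Qed.

Lemma decomposition_card_max_left_den : card_sets_eq (@max_left_den R) n.
Proof.
have K_incl i j : subset_of (fun x => ~ K i x) (fun x => ~ K j x) -> i = j.
  move=> sub; apply/eqP/negPn/negP => ij; have [c [nc cP]] := Kc i.
  by apply: (sub c nc); apply: cP; rewrite eq_sym.
exists (fun i x => ~ K i x); split=> [i|].
  split=> [|T T_den sub]; first exact: decomposition_left_den.
  have [j Tj] := left_den_sub_decomposition T_den.
  have -> // : i = j by apply: K_incl => x /sub /Tj.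
split=> [i j Kij|T [T_den T_max]]; first by apply: K_incl => x /Kij.
have [i Ti] := left_den_sub_decomposition T_den; exists i => x; split; first exact: Ti.
by apply: (T_max (fun x => ~ K i x)) => //; exact: decomposition_left_den.
Qed.

Lemma decomposition_semiprime : semiprime_ring R.
Proof.
move=> I idI [k nilI] x Ix; apply: K_eq0 => i.
have Kx m : K i (x ^+ m) -> K i x.
  by elim: m => [/K_1//|m IH]; rewrite exprS => /KM[].
apply: (Kx k.+1); suff -> : x ^+ k.+1 = 0 by exact: ideal_zero.
rewrite -(nilI (nseq k.+1 x)) ?size_nseq //.
  by rewrite big_nseq -Monoid.iteropE /=.
by move=> y /nseqP[->].
Qed.

Lemma decomposition_card_min_primes : card_sets_eq (@minimal_prime R) n.
Proof.
case: K_dec => hK h0 hc _; apply: card_minimal_primes h0 hc => i.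
exact: completely_prime_elementwise.
Qed.

(** A left annihilator depends only on the set of indices i for which X is not contained in K_i;
    finiteness of the index set then gives the chain condition. *)
Lemma decomposition_lann X r :
  lann X r <-> forall i, (exists x, X x /\ ~ K i x) -> K i r.
Proof.
split=> [Xr i [x [Xx nKx]]|h x Xx].
  by have : K i (r * x) by [rewrite Xr //; exact: ideal_zero]; case/KM.
apply: K_eq0 => i; have [Kx|nKx] := EM (K i x); first exact: ideal_mull.
by apply: ideal_mulr => //; apply: h; exists x.
Qed.

Lemma decomposition_acc : acc_left_annihilators R.
Proof.
move=> X X_incr.
pose supp k := [set i | `[< exists x, X k x /\ ~ K i x >]]%SET.
(* If i is not in [supp k], the separating element c of index i annihilates X k, hence X k.+1. As c
   is outside K_i, the index i is not in [supp k.+1]. *)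
have supp_sub k : (supp k.+1 \subset supp k)%SET.
  apply/subsetP => i; rewrite !inE => /asboolP hi; apply/asboolP.
  apply: contrapT => ni; have [c [nc cP]] := Kc i; apply: (nc).
  have /X_incr/decomposition_lann : lann (X k) c.
    apply/decomposition_lann => j [x hx]; apply: cP.
    by apply/eqP => ji; apply: ni; rewrite -ji; exists x.
  exact.
have supp_mono k l : (k <= l)%N -> supp l \subset supp k.
  elim: l => [|l IH]; first by rewrite leqn0 => /eqP->.
  rewrite leq_eqVlt => /orP[/eqP->//|]; rewrite ltnS => /IH.
  exact: subset_trans.
(* A support of least cardinality cannot shrink any further, so the chain is stationary from there
   on. *)
have ex_card : exists d, `[< exists k, #|supp k| = d >].
  by exists #|supp 0%N|; apply/asboolP; exists 0%N.
case: (ex_minnP ex_card) => d /asboolP[N <-] N_min.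
exists N => k Nk r /decomposition_lann h; apply/decomposition_lann => i hi.
apply: h; have : supp k = supp N.
  apply/eqP; rewrite eqEcard supp_mono //=; apply: N_min.
  by apply/asboolP; exists k.
by move/setP => /(_ i); rewrite !inE (asboolT hi) => /asboolP.
Qed.

(** Among n + 1 nonzero elements, two lie outside the same K_j. The Ore condition modulo K_j gives
    them a common nonzero left multiple, against independence. *)
Lemma decomposition_udim : udim_eq R n.
Proof.
split.
  exists (fun i x => forall j, j != i -> K j x).
  split=> [i|]; last exact: separated_independent.
  split; first exact: separated_left_ideal.
  have [c [nc cP]] := Kc i; exists c; split=> // c0.
  by apply: nc; rewrite c0; exact: ideal_zero.
move=> [L [L_left L_ind]].
have /choice[x xP] i : exists x, L i x /\ x <> 0 by case: (L_left i).
have /choice[e eP] i : exists j, ~ K j (x i).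
  by apply/existsNP => /K_eq0; case: (xP i).
have /injectivePn[k [l kl ekl]] : ~~ injectiveb e.
  by apply/negP => /injectiveP/leq_card; rewrite !card_ord ltnn.
have [c [nc cP]] := Kc (e k).
have nl : ~ K (e k) (x l) by rewrite ekl; exact: eP.
have [s [r [ns hK]]] := K_ore (x k) nl.
have e_sr : c * s * x k = c * r * x l.
  apply: subr0_eq; rewrite -!mulrA -mulrBr; apply: K_eq0 => j.
  have [->|ji] := eqVneq j (e k); first exact: ideal_mull.
  by apply: ideal_mulr => //; exact: cP.
pose z i := if i == k then c * s * x k else if i == l then - (c * r * x l) else 0.
have Lz i : L i (z i).
  rewrite /z; case: eqVneq => [->|_].
    by case: (L_left k) => -[_ [_ h]] _; apply: h; case: (xP k).
  case: eqVneq => [->|_]; last by case: (L_left i) => -[].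
  case: (L_left l) => -[_ [_ h]] _; rewrite -mulNr; apply: h; case: (xP l) => //.
have sz : \sum_i z i = 0.
  rewrite (bigD1 k) //= (bigD1 l) 1?eq_sym //= big1 => [|i /andP[ik il]].
    by rewrite /z eqxx (negPf (_ : l != k)) 1?eq_sym // eqxx e_sr addr0 subrr.
  by rewrite /z (negPf ik) (negPf il).
have := L_ind z Lz sz k; rewrite /z eqxx => z0.
have : K (e k) (c * s * x k) by rewrite z0; exact: ideal_zero.
by apply: nKM; [exact: nKM|exact: eP].
Qed.

End OreDecomposition.

(** * Dense embeddings into products of division rings *)

Section ProductRing.
Variables (I : Type) (D : I -> nzRingType).

Definition prod_ring : Type := forall i, D i.

Implicit Types a b c : prod_ring.

Fact prod_addA : associative (fun a b : prod_ring => (fun i => a i + b i) : prod_ring).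
Proof. by move=> a b c; apply: functional_extensionality_dep => i; rewrite addrA. Qed.
Fact prod_addC : commutative (fun a b : prod_ring => (fun i => a i + b i) : prod_ring).
Proof. by move=> a b; apply: functional_extensionality_dep => i; rewrite addrC. Qed.
Fact prod_add0 :
  left_id (fun=> 0) (fun a b : prod_ring => (fun i => a i + b i) : prod_ring).
Proof. by move=> a; apply: functional_extensionality_dep => i; rewrite add0r. Qed.
Fact prod_addN : left_inverse (fun=> 0) (fun a : prod_ring => (fun i => - a i) : prod_ring)
  (fun a b : prod_ring => (fun i => a i + b i) : prod_ring).
Proof. by move=> a; apply: functional_extensionality_dep => i; rewrite addNr. Qed.
Fact prod_mulA : associative (fun a b : prod_ring => (fun i => a i * b i) : prod_ring).
Proof. by move=> a b c; apply: functional_extensionality_dep => i; rewrite mulrA. Qed.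
Fact prod_mul1l :
  left_id (fun=> 1) (fun a b : prod_ring => (fun i => a i * b i) : prod_ring).
Proof. by move=> a; apply: functional_extensionality_dep => i; rewrite mul1r. Qed.
Fact prod_mul1r :
  right_id (fun=> 1) (fun a b : prod_ring => (fun i => a i * b i) : prod_ring).
Proof. by move=> a; apply: functional_extensionality_dep => i; rewrite mulr1. Qed.
Fact prod_mulDl : left_distributive (fun a b : prod_ring => (fun i => a i * b i) : prod_ring)
  (fun a b : prod_ring => (fun i => a i + b i) : prod_ring).
Proof. by move=> a b c; apply: functional_extensionality_dep => i; rewrite mulrDl. Qed.
Fact prod_mulDr : right_distributive (fun a b : prod_ring => (fun i => a i * b i) : prod_ring)
  (fun a b : prod_ring => (fun i => a i + b i) : prod_ring).
Proof. by move=> a b c; apply: functional_extensionality_dep => i; rewrite mulrDr. Qed.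

HB.instance Definition _ := gen_eqMixin prod_ring.
HB.instance Definition _ := gen_choiceMixin prod_ring.
HB.instance Definition _ := GRing.isPzRing.Build prod_ring prod_addA prod_addC
  prod_add0 prod_addN prod_mulA prod_mul1l prod_mul1r prod_mulDl prod_mulDr.

Definition prod_proj i (a : prod_ring) : D i := a i.

Fact prod_proj_is_zmod_morphism i : zmod_morphism (@prod_proj i). Proof. by []. Qed.
Fact prod_proj_is_monoid_morphism i : monoid_morphism (@prod_proj i). Proof. by []. Qed.
HB.instance Definition _ i :=
  GRing.isZmodMorphism.Build prod_ring (D i) (@prod_proj i) (prod_proj_is_zmod_morphism i).
HB.instance Definition _ i :=
  GRing.isMonoidMorphism.Build prod_ring (D i) (@prod_proj i) (prod_proj_is_monoid_morphism i).

Variables (R : pzRingType) (phi : forall i, {rmorphism R -> D i}).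

Definition prod_map (r : R) : prod_ring := fun i => phi i r.

Fact prod_map_is_zmod_morphism : zmod_morphism prod_map.
Proof. by move=> r s; apply: functional_extensionality_dep => i; exact: rmorphB. Qed.
Fact prod_map_is_monoid_morphism : monoid_morphism prod_map.
Proof.
split=> [|r s]; apply: functional_extensionality_dep => i; [exact: rmorph1|exact: rmorphM].
Qed.
HB.instance Definition _ :=
  GRing.isZmodMorphism.Build R prod_ring prod_map prod_map_is_zmod_morphism.
HB.instance Definition _ :=
  GRing.isMonoidMorphism.Build R prod_ring prod_map prod_map_is_monoid_morphism.

End ProductRing.

Lemma iso_prod_division_rings_prod n (D : 'I_n -> nzRingType) :
  (forall i, division_ring (D i)) -> iso_prod_division_rings (prod_ring D) n.
Proof.
move=> D_div; exists D; split=> //; exists (fun i => @prod_proj _ D i).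
split=> [a b ab|d]; last by exists d.
by apply: functional_extensionality_dep; exact: ab.
Qed.

Section Embedding.
Variables (R : pzRingType) (n : nat).
Implicit Types (r s x y : R).

(** Expresses that R is a left order in the product of the D_i, componentwise and without forming
    the product ring. *)
Definition dense_embedding (D : 'I_n -> nzRingType) (phi : forall i, {rmorphism R -> D i}) :=
  [/\ forall i, division_ring (D i),
      forall x, (forall i, phi i x = 0) -> x = 0 &
      forall d : forall i, D i, exists s r, forall i, phi i s <> 0 /\ phi i s * d i = phi i r].

Lemma division_ring_mul_eq0 (D : nzRingType) (x y : D) :
  division_ring D -> x * y = 0 -> x = 0 \/ y = 0.
Proof.
move=> D_div xy; have [->|x0] := EM (x = 0); [by left|right].
have [z [_ zx]] := D_div x x0.
by rewrite -[y]mul1r -zx -mulrA xy mulr0.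
Qed.

Section Properties.
Variables (D : 'I_n -> nzRingType) (phi : forall i, {rmorphism R -> D i}).
Hypothesis phiP : dense_embedding phi.

Let D_div i : division_ring (D i). Proof. by case: phiP. Qed.
Let phi_inj x : (forall i, phi i x = 0) -> x = 0. Proof. by case: phiP => _ h _; exact: h. Qed.
Let phi_dense (d : forall i, D i) :
  exists s r, forall i, phi i s <> 0 /\ phi i s * d i = phi i r.
Proof. by case: phiP. Qed.

Lemma embedding_separating i : exists c, phi i c <> 0 /\ forall j, j != i -> phi j c = 0.
Proof.
(* The i-th idempotent of the product is a fraction s^-1 r, and its numerator r separates i from the
   other indices. *)
have [s [r h]] := phi_dense (fun j => if j == i then 1 else 0).
exists r; split=> [|j ji]; last by case: (h j) => _ <-; rewrite (negPf ji) mulr0.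
by case: (h i) => si <-; rewrite eqxx mulr1.
Qed.

Lemma embedding_regular x : regular x <-> forall i, phi i x <> 0.
Proof.
split=> [[xr _] i xi|h].
  have [c [ci cP]] := embedding_separating i; apply: ci.
  suff -> : c = 0 by rewrite rmorph0.
  apply: xr; apply: phi_inj => j; rewrite rmorphM.
  by have [->|ji] := eqVneq j i; [rewrite xi mul0r|rewrite cP ?mulr0].
split=> y e; apply: phi_inj => i.
  have : phi i x * phi i y = 0 by rewrite -rmorphM e rmorph0.
  by case/(division_ring_mul_eq0 (@D_div i)) => // /h.
have : phi i y * phi i x = 0 by rewrite -rmorphM e rmorph0.
by case/(division_ring_mul_eq0 (@D_div i)) => // /h.
Qed.

(** One choice of s' and r' serves for all components; it yields both the Ore condition modulo each
    kernel and that for the regular elements. *)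
Lemma embedding_ore r s : exists s' r', forall i,
  phi i s' <> 0 /\ (phi i s <> 0 -> phi i (s' * r - r' * s) = 0).
Proof.
have inv i : exists z : D i, phi i s <> 0 -> z * phi i s = 1.
  by have [->|/D_div[z [_ zs]]] := EM (phi i s = 0); [exists 0|exists z].
(* The fraction s'^-1 r' represents the family phi_i(r) phi_i(s)^-1. Where phi_i(s) = 0, the inverse
   is replaced by an arbitrary element. *)
have [s' [r' h]] := phi_dense (fun i => phi i r * projT1 (cid (inv i))).
exists s', r' => i; case: (h i) => s'0 e; split=> // s0.
rewrite rmorphB !rmorphM -e -!mulrA (projT2 (cid (inv i))) //.
by rewrite mulr1 subrr.
Qed.

Lemma embedding_decomposition : ore_decomposition (fun i x => phi i x = 0).
Proof.
split=> [i||i|i r s si].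
- split=> [||x y].
  + do !split; rewrite ?rmorph0 //.
    * by move=> x y /= hx hy; rewrite rmorphB hx hy subrr.
    * by move=> r x /= hx; rewrite rmorphM hx mulr0.
    * by move=> r x /= hx; rewrite rmorphM hx mul0r.
  + by rewrite rmorph1; exact/eqP/oner_neq0.
  + by rewrite rmorphM; exact: division_ring_mul_eq0.
- exact: phi_inj.
- exact: embedding_separating.
- have [s' [r' h]] := embedding_ore r s; exists s', r'.
  by case: (h i) => s'0 e; split=> //; exact: e.
Qed.

Lemma embedding_left_ore : (0 < n)%N -> left_ore (@regular R).
Proof.
move=> n0; split.
  split; first by split=> y; rewrite ?mul1r ?mulr1.
  (* A component must exist for 0 not to be regular; in the zero ring 0 is regular. *)
  split; first by move=> /embedding_regular/(_ (Ordinal n0)); rewrite rmorph0.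
  move=> a b /embedding_regular ha /embedding_regular hb; apply/embedding_regular => i.
  by rewrite rmorphM => /(division_ring_mul_eq0 (@D_div i))[/ha|/hb].
move=> r s /embedding_regular hs; have [s' [r' h]] := embedding_ore r s.
exists s', r'; split; first by apply/embedding_regular => i; case: (h i).
by apply: subr0_eq; apply: phi_inj => i; case: (h i) => _; apply.
Qed.

Lemma embedding_localization : is_left_localization (@regular R) (prod_map phi).
Proof.
split; [|split].
- move=> s /embedding_regular hs.
  have inv i : exists u, phi i s * u = 1 /\ u * phi i s = 1 by exact: (D_div (hs i)).
  exists (fun i => projT1 (cid (inv i))).
  by split; apply: functional_extensionality_dep => i; case: (projT2 (cid (inv i))).
- move=> q; have [s [r h]] := phi_dense q; exists s, r.
  split; first by apply/embedding_regular => i; case: (h i).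
  by apply: functional_extensionality_dep => i; case: (h i).
- move=> r; split=> [e|[s [[s_reg _] /s_reg ->]]]; last by rewrite rmorph0.
  exists 1; rewrite mul1r; split; first by split=> y; rewrite ?mul1r ?mulr1.
  by apply: phi_inj => i; rewrite -[phi i r]/(prod_map phi r i) e.
Qed.

End Properties.

Lemma localization_embedding (S : R -> Prop) (Q : pzRingType) (f : {rmorphism R -> Q}) :
  subset_of S (@regular R) -> is_left_localization S f -> iso_prod_division_rings Q n ->
  exists (D : 'I_n -> nzRingType) (phi : forall i, {rmorphism R -> D i}), dense_embedding phi.
Proof.
move=> S_reg [f_unit [f_frac f_ker]] [D [D_div [psi [psi_inj psi_surj]]]].
exists D, (fun i => psi i \o f : {rmorphism R -> D i}); split=> //.
  move=> x hx; have /f_ker[s [/S_reg[s_reg _] /s_reg //]] : f x = 0.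
  by apply: psi_inj => i; rewrite rmorph0; exact: hx.
move=> d; have [q qd] := psi_surj d; have [s [r [Ss e]]] := f_frac q.
exists s, r => i /=; rewrite -qd -rmorphM e; split=> // s0.
have [u [su _]] := f_unit s Ss; have /eqP[] := oner_neq0 (D i).
by rewrite -(rmorph1 (psi i)) -su rmorphM s0 mul0r.
Qed.

(** A nonzero fraction s^-1 r has its numerator r outside [ass S], hence in S, so r is invertible in
    the localization. *)
Lemma localization_division_ring (S : R -> Prop) : left_den S ->
    (forall r, ~ ass S r -> S r) ->
  exists (D : nzRingType) (g : {rmorphism R -> D}),
    division_ring D /\ is_left_localization S g.
Proof.
move=> S_den S_compl; have [Q [f f_loc]] := localization_exists S_den.
have [f_unit [f_frac f_ker]] := f_loc.
have Q_nz : (1 : Q) != 0.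
  apply/eqP; rewrite -(rmorph1 f) => /f_ker[s [Ss]]; rewrite mulr1 => s0.
  by case: S_den => -[[_ [nS0 _]] _] _; apply: nS0; rewrite -s0.
pose D : nzRingType := HB.pack Q (GRing.PzSemiRing_isNonZero.Build Q Q_nz).
exists D, f; split=> // q q0; have [s [r [Ss e]]] := f_frac q.
have [u [su us]] := f_unit s Ss.
have /f_unit[v [rv vr]] : S r.
  apply: S_compl => /f_ker r0; apply: q0.
  by rewrite -[q]mul1r -us -mulrA e r0 mulr0.
have eq : q = u * f r by rewrite -e mulrA us mul1r.
exists (v * f s); rewrite eq; split; last by rewrite mulrA -(mulrA v) su mulr1.
by rewrite mulrA -(mulrA u) rv mulr1.
Qed.

Lemma decomposition_embedding (K : 'I_n -> R -> Prop) : ore_decomposition K ->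
  exists (D : 'I_n -> nzRingType) (phi : forall i, {rmorphism R -> D i}), dense_embedding phi.
Proof.
move=> K_dec; have [_ K0 Kc _] := K_dec.
have /choice[F FP] i : exists F : {D : nzRingType & {rmorphism R -> D}},
    division_ring (projT1 F) /\ is_left_localization (fun x => ~ K i x) (projT2 F).
  have [|D [g h]] := localization_division_ring (decomposition_left_den K_dec i).
    by move=> r nr Kr; apply: nr; exact/decomposition_ass.
  by exists (existT _ D g).
exists (fun i => projT1 (F i)), (fun i => projT2 (F i)).
have kerE i x : projT2 (F i) x = 0 <-> K i x.
  by case: (FP i) => _ [_ [_ ker]]; rewrite ker; exact: decomposition_ass.
split=> [i|x hx|d]; first by case: (FP i).
  by apply: K0 => i; apply/kerE.
have /choice[sr srP] i : exists sr : R * R,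
    ~ K i sr.1 /\ projT2 (F i) sr.1 * d i = projT2 (F i) sr.2.
  by case: (FP i) => _ [_ [frac _]]; have [s [r h]] := frac (d i); exists (s, r).
have /choice[c cP] := Kc.
(* Only the i-th summand survives in component i. So the sums of the c_j s_j and of the c_j r_j are
   a common denominator and numerator for the separately chosen fractions s_i^-1 r_i. *)
have sumE (a : 'I_n -> R) i : projT2 (F i) (\sum_j c j * a j) = projT2 (F i) (c i * a i).
  rewrite rmorph_sum (bigD1 i) //= big1 ?addr0 // => j ji; rewrite rmorphM.
  suff -> : projT2 (F i) (c j) = 0 by rewrite mul0r.
  by apply/kerE; case: (cP j) => _; apply; rewrite eq_sym.
exists (\sum_j c j * (sr j).1), (\sum_j c j * (sr j).2) => i.
have [si e] := srP i; rewrite !sumE; split.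
  by move=> /kerE; case: (K_dec) => /(_ i)[_ _ KM] _ _ _ /KM[] //; case: (cP i).
by rewrite !rmorphM -mulrA e.
Qed.

End Embedding.

(** * Orthogonal families *)

Lemma left_den_sub_max (R : pzRingType) (T : R -> Prop) : left_den T ->
  exists M, max_left_den M /\ subset_of T M.
Proof.
(* Adjoining T to every set makes the union of the empty chain admissible and forces the maximal set
   to contain T. *)
move=> T_den; pose U (X : R -> Prop) := fun x => X x \/ T x.
have U_den (F : (R -> Prop) -> Prop) : (forall X, F X -> left_den (U X)) ->
    classical_sets.total_on F (fun X Y => subset_of X Y) ->
    left_den (U (fun x => exists2 X, F X & X x)).
  move=> F_den F_tot; set V := U _.
  (* The conditions on V involve at most two of its elements at a time, and these lie in a common
     left denominator set of the chain. *)
  have V_local a : V a -> exists W, [/\ left_den W, subset_of W V, W a &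
      W = T \/ exists2 X, F X & W = U X].
    case=> [[X FX Xa]|Ta]; last by exists T; split=> //; [right|left].
    exists (U X); split; [exact: F_den| |by left|by right; exists X].
    by move=> x [Xx|]; [left; exists X|right].
  have V_local2 a b : V a -> V b -> exists W, [/\ left_den W, subset_of W V, W a & W b].
    move=> /V_local[W [W_den WV Wa eW]] /V_local[W' [W_den' WV' Wb eW']].
    suff [WW'|W'W] : subset_of W W' \/ subset_of W' W.
    - by exists W'; split=> //; exact: WW'.
    - by exists W; split=> //; exact: W'W.
    case: eW => [->|[X FX ->]]; case: eW' => [->|[Y FY ->]]; first by left.
    - by left=> x; right.
    - by right=> x; right.
    - have [XY|YX] := F_tot _ _ FX FY; [left|right] => x [h|h]; try by right.
      + by left; exact: XY.
      + by left; exact: YX.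
  split; first split.
  - split; first by right; case: T_den => -[[]].
    split=> [/V_local[W [[[[_ [W0 _]] _] _] _ /W0]] //|a b Va Vb].
    have [W [[[[_ [_ WM]] _] _] WV Wa Wb]] := V_local2 _ _ Va Vb.
    by apply: WV; exact: WM.
  - move=> r s /V_local[W [[[_ W_ore] _] WV Ws _]].
    by have [s' [r' [Ws' e]]] := W_ore r s Ws; exists s', r'; split=> //; exact: WV.
  - move=> r s /V_local[W [[_ W_rev] WV Ws _]] /(W_rev _ _ Ws)[t [Wt e]].
    by exists t; split=> //; exact: WV.
have [F FP F_tot|A [A_den A_max]] :=
    @classical_sets.Zorn_bigcup R (fun X => left_den (U X)).
  exact: U_den.
exists (U A); split; last by move=> x; right.
split=> // W W_den AW x Wx; apply: contrapT => nAx.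
have AW' : classical_sets.proper A W.
  split=> [y Ay|WA]; first by apply: AW; left.
  by apply: nAx; left; exact: WA.
have U_W : U W = W.
  apply/funext => y; apply/propext; split; last by left.
  by case=> // Ty; apply: AW; right.
by case: (A_max W AW'); rewrite U_W.
Qed.

Section OrthogonalFamilies.
Variable R : pzRingType.
Implicit Types (a r s u x y : R).

Definition orthogonal_family m (a : 'I_m -> R) :=
  (forall i, a i <> 0) /\ forall i j r, i != j -> a i * r * a j = 0.

(** The right annihilator of the right ideal a R. *)
Definition ann a x := forall r, a * r * x = 0.

Definition elementwise_semiprime := forall x, ann x x -> x = 0.

Lemma ann_ideal a : ideal (ann a).
Proof.
split; first by move=> r; rewrite mulr0.
split; first by move=> x y hx hy r; rewrite mulrBr hx hy subrr.
split=> s x hx r; first by rewrite mulrA -(mulrA a) hx.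
by rewrite mulrA hx mul0r.
Qed.

(** If x R x = 0, let A be the left annihilator of R x and B the right annihilator of A. The
    intersection of A and B is an ideal of square zero that contains x. *)
Lemma semiprime_elementwise : semiprime_ring R -> elementwise_semiprime.
Proof.
move=> R_sp x xx; pose A y := forall r, y * r * x = 0.
pose B z := forall y, A y -> ann y z.
apply: (R_sp (fun z => A z /\ B z)).
- split; first by split=> [r|y _ r]; rewrite ?mulr0 ?mul0r.
  split.
    move=> y z [Ay By] [Az Bz]; split=> [r|w Aw]; first by rewrite !mulrBl Ay Az subrr.
    exact: (ideal_sub (ann_ideal w) (By w Aw) (Bz w Aw)).
  split=> s y [Ay By]; split=> [r|w Aw].
  + by rewrite -!mulrA (mulrA y) Ay mulr0.
  + exact: (ideal_mull _ (ann_ideal w) (By w Aw)).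
  + by rewrite -(mulrA y) Ay.
  + exact: (ideal_mulr s (ann_ideal w) (By w Aw)).
- exists 1%N => -[|y [|z [|]]] // _ hI; rewrite !big_cons big_nil mulr1.
  have [Ay _] := hI y (mem_head _ _).
  have [_ Bz] : A z /\ B z by apply: hI; rewrite !inE eqxx orbT.
  by rewrite -[y]mulr1; exact: Bz.
- by split=> // y; exact.
Qed.

Hypothesis R_sp : elementwise_semiprime.

Lemma ann_sym a x : ann a x -> ann x a.
Proof.
move=> ax r; apply: R_sp => s.
have -> : x * r * a * s * (x * r * a) = x * r * (a * s * x) * (r * a) by rewrite !mulrA.
by rewrite ax mulr0 mul0r.
Qed.

Lemma orthogonal_extend m (a : 'I_m -> R) x : orthogonal_family a -> x <> 0 ->
  (forall i, ann (a i) x) -> exists b : 'I_m.+1 -> R, orthogonal_family b.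
Proof.
move=> [a0 aa] x0 ax; exists (fun k => oapp a x (unlift ord0 k)).
split=> [k|k l r]; first by case: (unliftP ord0 k) => [i _|_] //=; exact: a0.
case: (unliftP ord0 k) => [i ->|->]; case: (unliftP ord0 l) => [j ->|->] //.
- by rewrite (inj_eq lift_inj); exact: aa.
- by move=> _; exact: ax.
- by move=> _; exact: (ann_sym (ax j)).
Qed.

(* Maximality forces primeness: if x and y violate it for ann (a i), then a i
   can be split into two orthogonal nonzero elements (a i) u x and (a i) v y. *)
Lemma maximal_orthogonal_family N :
  (forall m (a : 'I_m -> R), orthogonal_family a -> (m <= N)%N) ->
  exists m (a : 'I_m -> R), [/\ orthogonal_family a,
    forall i, elementwise_prime (ann (a i)) &
    forall x, (forall i, ann (a i) x) -> x = 0].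
Proof.
move=> bound.
have ex0 : exists m, `[< exists a : 'I_m -> R, orthogonal_family a >].
  by exists 0%N; apply/asboolP; exists (fun=> 0); split=> -[].
have ubN m : `[< exists a : 'I_m -> R, orthogonal_family a >] -> (m <= N)%N.
  by move=> /asboolP[a]; exact: bound.
case: (ex_maxnP ex0 ubN) => m /asboolP[a a_orth] m_max.
have no_ext : ~ exists b : 'I_m.+1 -> R, orthogonal_family b.
  by move=> /asboolP /m_max; rewrite ltnn.
exists m, a; split=> // [i|x ax]; last first.
  by apply: contrapT => x0; apply: no_ext; exact: orthogonal_extend ax.
case: (a_orth) => a0 aa; split; first exact: ann_ideal.
  by move=> /(_ 1); rewrite !mulr1; exact: a0.
move=> x y axy; apply: contrapT => /not_orP[/existsNP[u au] /existsNP[v av]].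
apply: no_ext; pose b k := if k == i then a i * u * x else a k.
apply: (@orthogonal_extend m b (a i * v * y)) => //.
  split=> [k|k l r kl]; rewrite /b; first by case: ifP => // _; exact: a0.
  case: eqVneq => [ki|ki]; case: eqVneq => [li|li]; last exact: aa.
  - by move: kl; rewrite ki li eqxx.
  - by rewrite -!mulrA (mulrA u) (mulrA (u * x)) mulrA aa // eq_sym.
  - by rewrite !mulrA aa ?mul0r.
move=> k r; rewrite /b; case: eqVneq => [_|ki]; last by rewrite !mulrA aa ?mul0r.
by have := axy (r * a i * v) u; rewrite !mulrA.
Qed.

Lemma orthogonal_separated m (a : 'I_m -> R) i : orthogonal_family a ->
  exists c, ~ ann (a i) c /\ forall j, j != i -> ann (a j) c.
Proof.
move=> [a0 aa]; exists (a i); split; first by move/R_sp; exact: a0.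
by move=> j ji r; exact: aa.
Qed.

(** Multiplying the vanishing sum by x_i r on the left kills all terms but one, so x_i R x_i = 0. *)
Lemma orthogonal_independent m (a : 'I_m -> R) : orthogonal_family a ->
  independent_left_ideals (fun i x => exists r, x = r * a i).
Proof.
move=> [a0 aa] x xa sx i; apply: R_sp => r.
have /esym : x i * r * \sum_j x j = 0 by rewrite sx mulr0.
rewrite (bigD1 i) //= mulrDr mulr_sumr big1 ?addr0 // => j ji.
have [[s ->] [t ->]] := (xa i, xa j).
have -> : s * a i * r * (t * a j) = s * (a i * (r * t) * a j) by rewrite !mulrA.
by rewrite aa ?mulr0 // eq_sym.
Qed.

Lemma orthogonal_udim m n (a : 'I_m -> R) : udim_eq R n -> orthogonal_family a -> (m <= n)%N.
Proof.
move=> [_ no_ind] [a0 aa]; rewrite leqNgt; apply/negP => nm; apply: no_ind.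
have b_orth : orthogonal_family (fun i : 'I_n.+1 => a (widen_ord nm i)).
  by split=> [i|i j r ij]; [exact: a0|exact: aa].
eexists; split; last exact: orthogonal_independent b_orth.
move=> i /=; split.
  split; first by exists 0; rewrite mul0r.
  split; first by move=> _ _ [r ->] [s ->]; exists (r - s); rewrite mulrBl.
  by move=> r _ [s ->]; exists (r * s); rewrite mulrA.
by exists (a (widen_ord nm i)); split=> //; exists 1; rewrite mul1r.
Qed.

End OrthogonalFamilies.

(** * Left localizable rings *)

Section Localizable.
Variables (R : pzRingType) (n : nat).
Hypotheses (R_loc : left_localizable R) (R_card : card_sets_eq (@max_left_den R) n).
Implicit Types (a r s u x y : R).

Lemma localizable_reduced x : x * x = 0 -> x = 0.
Proof.
move=> xx; apply: contrapT => /R_loc[S [[[[_ [S0 SM]] _] _] Sx]].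
by apply: S0; rewrite -xx; exact: SM.
Qed.

Lemma reduced_mulC_eq0 x y : x * y = 0 -> y * x = 0.
Proof.
by move=> xy; apply: localizable_reduced; rewrite mulrA -(mulrA y) xy mulr0 mul0r.
Qed.

Lemma reduced_mul_eq0 x y r : x * y = 0 -> x * r * y = 0.
Proof.
move=> /reduced_mulC_eq0 yx; apply: localizable_reduced.
have -> : x * r * y * (x * r * y) = x * r * (y * x) * (r * y) by rewrite !mulrA.
by rewrite yx mulr0 mul0r.
Qed.

Lemma localizable_semiprime : elementwise_semiprime R.
Proof. by move=> x /(_ 1); rewrite mulr1; exact: localizable_reduced. Qed.

(** Each a_i lies in a maximal left denominator set; two of them in the same set would put their
    product 0 into it. *)
Lemma localizable_orthogonal_bound m (a : 'I_m -> R) :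
  orthogonal_family a -> (m <= n)%N.
Proof.
move=> [a0 aa]; have [F [F_max [_ F_surj]]] := R_card.
have /choice[k kP] i : exists k, F k (a i).
  have [S [/left_den_sub_max[M [M_max SM]] Sa]] := R_loc (a0 i).
  by have [k MF] := F_surj M M_max; exists k; apply/MF; exact: SM.
rewrite -(card_ord m) -(card_ord n); apply: (leq_card k) => i j kij.
apply/eqP/negPn/negP => ij; have [[[[_ [F0 FM]] _] _] _] := F_max (k i).
apply: F0; rewrite -(aa i j 1 ij) mulr1; apply: FM; first exact: kP.
by rewrite kij; exact: kP.
Qed.

Lemma localizable_decomposition : exists m (K : 'I_m -> R -> Prop), ore_decomposition K.
Proof.
have [m [a [a_orth a_prime a_eq0]]] :=
  maximal_orthogonal_family localizable_semiprime localizable_orthogonal_bound.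
exists m, (fun i => ann (a i)); split=> // [i|i|i r s].
- have [ann_id ann1 annP] := a_prime i; split=> // x y axy; apply: annP => s r.
  by rewrite mulrA mulrA; apply: reduced_mul_eq0; rewrite -mulrA; exact: axy.
- exact: (orthogonal_separated localizable_semiprime).
- move=> /existsNP[u aus].
  (* The Ore condition in a set S containing a_i u s gives s' r = r' a_i u s exactly. If s' were in
     K_i, then s' a_i = 0 by reducedness, and 0 = s' a_i u s would lie in S. *)
  have [S [[[[_ [S0 SM]] S_ore] _] Saus]] := R_loc aus.
  have [s' [r' [Ss' e]]] := S_ore r _ Saus.
  exists s', (r' * (a i * u)); split; last first.
    by rewrite e !mulrA subrr; exact: ideal_zero (ann_ideal _).
  move=> /(_ 1); rewrite mulr1 => /reduced_mulC_eq0 s'a; apply: S0.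
  rewrite -(mul0r (u * s)) -s'a; have := SM _ _ Ss' Saus.
  by rewrite !mulrA.
Qed.

End Localizable.

(** * Semiprime left Goldie rings *)

Section Goldie.
Variables (R : pzRingType) (n : nat) (K : 'I_n -> R -> Prop).
Hypotheses (K_prime : forall i, elementwise_prime (K i))
  (K_eq0 : forall x, (forall i, K i x) -> x = 0)
  (K_sep : forall i, exists c, ~ K i c /\ forall j, j != i -> K j c)
  (R_acc : acc_left_annihilators R) (R_udim : udim_eq R n).
Implicit Types (a r s u x y z : R).

Let idK i : ideal (K i). Proof. by case: (K_prime i). Qed.

Let U i x := forall j, j != i -> K j x.

Let U_ideal i : ideal (U i).
Proof.
have [U0 [UB UMl]] := separated_left_ideal i idK; do !split=> //.
by move=> r x Ux j ji; apply: ideal_mulr => //; exact: Ux.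
Qed.

Let U0 i : U i 0. Proof. by case: (U_ideal i). Qed.
Let UB i x y : U i x -> U i y -> U i (x - y). Proof. exact: (ideal_sub (U_ideal i)). Qed.
Let UMl i r x : U i x -> U i (r * x). Proof. exact: (ideal_mull r (U_ideal i)). Qed.
Let UMr i r x : U i x -> U i (x * r). Proof. exact: (ideal_mulr r (U_ideal i)). Qed.

(** U_i embeds in R / K_i, so questions modulo K_i can be settled inside U_i. *)
Let U_K i x : U i x -> K i x -> x = 0.
Proof. by move=> Ux Kx; apply: K_eq0 => j; have [->|/Ux] := eqVneq j i. Qed.

Let sp x : ann x x -> x = 0.
Proof.
move=> xx; apply: K_eq0 => i; case: (K_prime i) => _ _ h.
by case: (h x x) => // r; rewrite xx; exact: ideal_zero.
Qed.

(** If L and M met only in 0, then replacing U_i by the two left ideals L and M would give n + 1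
    independent nonzero left ideals. *)
Lemma separated_uniform i (L M : R -> Prop) : left_ideal L -> left_ideal M ->
  subset_of L (U i) -> subset_of M (U i) ->
  (exists x, L x /\ x <> 0) -> (exists x, M x /\ x <> 0) ->
  exists x, [/\ L x, M x & x <> 0].
Proof.
move=> L_id M_id LU MU L0 M0; apply: contrapT => noLM.
case: R_udim => _; apply.
pose V (k : 'I_n.+1) := if unlift ord0 k is Some j then
  (if j == i then L else U j) else M.
exists V; split=> [k|x Vx sx].
  rewrite /V; case: unliftP => [j _|_]; last by split.
  case: eqVneq => [_|_]; first by split.
  split; first exact: separated_left_ideal.
  have [c [nc cP]] := K_sep j; exists c; split=> // c0.
  by apply: nc; rewrite c0; exact: ideal_zero.
have Vx0 : M (x ord0) by have := Vx ord0; rewrite /V unlift_none.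
have Vxl j : if j == i then L (x (lift ord0 j)) else U j (x (lift ord0 j)).
  by have := Vx (lift ord0 j); rewrite /V liftK; case: ifP.
(* Merging the component in M with the one in L gives a vanishing sum over the independent U_j.
   Hence the two components are opposite and lie in both L and M. *)
pose y j := x (lift ord0 j) + (if j == i then x ord0 else 0).
have Uy j : U j (y j).
  have := Vxl j; rewrite /y; case: eqVneq => [-> Lx|_]; last by rewrite addr0.
  rewrite -[x ord0]opprK; apply: UB; first exact: LU.
  by rewrite -sub0r; apply: UB; [exact: U0|exact: MU].
have sy : \sum_j y j = 0.
  rewrite /y big_split -big_mkcond big_pred1_eq /= addrC.
  by move: sx; rewrite big_ord_recl.
have y0 := separated_independent idK K_eq0 Uy sy.
have x0 : x ord0 = 0.
  apply: contrapT => x0; apply: noLM; exists (x ord0); split=> //.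
  have := y0 i; rewrite /y eqxx => /eqP; rewrite addrC addr_eq0 => /eqP ->.
  rewrite -sub0r; case: (L_id) => L_0 [LB _]; apply: LB => //.
  by have := Vxl i; rewrite eqxx.
move=> k; case: (unliftP ord0 k) => [j ->|-> //].
by have := y0 j; rewrite /y x0; case: ifP => _; rewrite addr0.
Qed.

Lemma principal_left_ideal x : left_ideal (fun y => exists r, y = r * x).
Proof.
split; first by exists 0; rewrite mul0r.
split; first by move=> _ _ [r ->] [s ->]; exists (r - s); rewrite mulrBl.
by move=> r _ [s ->]; exists (r * s); rewrite mulrA.
Qed.

Lemma separated_left_annihilator_ideal i z :
  left_ideal (fun w => U i w /\ w * z = 0).
Proof.
split; first by rewrite mul0r; split=> //; exact: U0.
split=> [x y [Ux xz] [Uy yz]|r x [Ux xz]].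
  by rewrite mulrBl xz yz subrr; split=> //; exact: UB.
by rewrite -mulrA xz mulr0; split=> //; exact: UMl.
Qed.

(* The nonzero elements of U i annihilated on the left by a nonzero element of
   U i form the singular part. If z is one of them with lann z maximal and
   z r z <> 0, then lann (z r z) = lann z, and by uniformity some nonzero
   w z r kills z; but then w lies in lann (z r z) = lann z. *)
Lemma separated_domain i x y : U i x -> U i y -> x * y = 0 -> x = 0 \/ y = 0.
Proof.
move=> Ux Uy xy; apply: contrapT => /not_orP[x0 y0].
pose Z z := [/\ U i z, z <> 0 & exists w, [/\ U i w, w <> 0 & w * z = 0]].
have Zy : Z y by split=> //; exists x.
pose lann1 z := lann (fun t => t = z).
have [z [Zz z_max]] : exists z, Z z /\
    forall z', Z z' -> subset_of (lann1 z) (lann1 z') -> subset_of (lann1 z') (lann1 z).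
  apply: contrapT => /forallNP no_max.
  (* Without a maximal annihilator, iterating a choice of strictly larger ones from y contradicts
     the chain condition. *)
  have next (z : {z | Z z}) : exists z' : {z | Z z},
      subset_of (lann1 (sval z)) (lann1 (sval z')) /\
      ~ subset_of (lann1 (sval z')) (lann1 (sval z)).
    case: z => z Zz /=; apply: contrapT => /forallNP no_z'; apply: (no_max z).
    split=> // z' Zz' sub; apply: contrapT => nsub.
    by apply: (no_z' (exist _ z' Zz')).
  have [f fP] := choice next.
  pose X k := sval (iter k f (exist _ y Zy)).
  have [N NP] := R_acc (X := fun k t => t = X k) (fun k => (fP _).1).
  by apply: (fP (iter N f (exist _ y Zy))).2; exact: NP N.+1 (leqnSn N).
have [Uz z0 [w [Uw w0 wz]]] := Zz; apply: z0; apply: sp => r.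
apply: contrapT => zrz0.
have Zzrz : Z (z * r * z).
  split=> //; first exact: UMl.
  by exists w; split=> //; rewrite !mulrA wz !mul0r.
have sub : subset_of (lann1 (z * r * z)) (lann1 z).
  apply: z_max => // t tz _ ->; by rewrite -!mulrA mulrA tz ?mul0r.
have [t [[v ->] [_ vzrz] vzr0]] : exists t,
    [/\ exists v, t = v * (z * r), U i t /\ t * z = 0 & t <> 0].
  apply: (@separated_uniform i); first exact: principal_left_ideal.
  - exact: separated_left_annihilator_ideal.
  - by move=> _ [v ->]; apply: UMl; exact: UMr.
  - by move=> t [].
  - exists (z * r); split; first by exists 1; rewrite mul1r.
    by move=> zr0; apply: zrz0; rewrite zr0 mul0r.
  - by exists w; split=> //; split.
apply: vzr0; rewrite mulrA (sub v) ?mul0r // => _ ->.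
by rewrite -vzrz !mulrA.
Qed.

(** Primeness of K_i allows an element outside K_i to be moved to a nonzero element of U_i, here by
    a left factor and in [nK_U'] by a right one. *)
Let nK_U i s : ~ K i s -> exists a, [/\ U i a, U i (a * s) & a * s <> 0].
Proof.
move=> ns; have [c [nc Uc]] := K_sep i.
have /existsNP[u ncus] : ~ forall u, K i (c * u * s) by case: (K_prime i) => _ _ h /h[].
exists (c * u); split; first exact: UMr Uc.
  by do 2!apply: UMr.
by move=> e; apply: ncus; rewrite e; exact: ideal_zero.
Qed.

Let nK_U' i s : ~ K i s -> exists a, [/\ U i a, U i (s * a) & s * a <> 0].
Proof.
move=> ns; have [c [nc Uc]] := K_sep i.
have /existsNP[u nsuc] : ~ forall u, K i (s * u * c) by case: (K_prime i) => _ _ h /h[].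
exists (u * c); rewrite mulrA; split; first exact: UMl Uc.
  by apply: UMl.
by move=> e; apply: nsuc; rewrite e; exact: ideal_zero.
Qed.

Lemma goldie_decomposition : ore_decomposition K.
Proof.
split=> // [i|i r s ns].
  split=> // [|x y Kxy]; first by case: (K_prime i).
  (* The nonzero elements a x and y b of U_i have product in both U_i and K_i, hence 0, against
     [separated_domain]. *)
  apply: contrapT => /not_orP[/nK_U[a [_ Uax ax0]] /nK_U'[b [_ Uyb yb0]]].
  case: (separated_domain Uax Uyb) => //.
  apply: (@U_K i); first exact: UMl Uyb.
  rewrite mulrA -(mulrA a); apply: ideal_mulr => //; exact: ideal_mull.
have [Kr|nr] := EM (K i r).
  exists 1, 0; rewrite mul1r mul0r subr0; split=> //.
  by case: (K_prime i).
have [a [Ua Uar ar0]] := nK_U nr; have [b [Ub Ubs bs0]] := nK_U ns.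
(* A nonzero common left multiple p a r = q b s exists by uniformity. Its factor p a is outside K_i,
   since otherwise p a = 0. *)
have [t [[p pE] [q qE] t0]] : exists t,
    [/\ exists p, t = p * (a * r), exists q, t = q * (b * s) & t <> 0].
  apply: (@separated_uniform i); try exact: principal_left_ideal.
  - by move=> _ [p ->]; exact: UMl.
  - by move=> _ [p ->]; exact: UMl.
  - by exists (a * r); split=> //; exists 1; rewrite mul1r.
  - by exists (b * s); split=> //; exists 1; rewrite mul1r.
exists (p * a), (q * b); rewrite -!mulrA -pE -qE subrr.
split; last exact: ideal_zero.
move=> Kpa; apply: t0; rewrite pE mulrA (@U_K i (p * a)) ?mul0r //.
exact: UMl.
Qed.

End Goldie.

Lemma semiprime_goldie_decomposition (R : pzRingType) (n : nat) :
  semiprime_ring R -> acc_left_annihilators R -> udim_eq R n ->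
  card_sets_eq (@minimal_prime R) n ->
  exists K : 'I_n -> R -> Prop, ore_decomposition K.
Proof.
move=> /semiprime_elementwise R_sp R_acc R_udim R_min.
have [m [a [a_orth a_prime a_eq0]]] := maximal_orthogonal_family R_sp
  (fun m a => @orthogonal_udim _ R_sp m n a R_udim).
have a_sep i := orthogonal_separated R_sp i a_orth.
(* Here the number of minimal primes is matched with the uniform dimension, which the uniformity of
   the U_i requires. *)
have mn : m = n.
  by apply: card_sets_eq_unique R_min; exact: card_minimal_primes a_sep.
subst m; exists (fun i => ann (a i)).
exact: goldie_decomposition.
Qed.

(** * Equivalence of the four conditions *)

Theorem theorem3p9 (R : pzRingType) (n : nat) (hn : (1 <= n)%N) :
  let P1 := left_localizable R /\ card_sets_eq (@max_left_den R) n in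
  let P2 := left_ore (@regular R) /\
            exists (Q : pzRingType) (f : {rmorphism R -> Q}),
              is_left_localization (@regular R) f /\ iso_prod_division_rings Q n in
  let P3 := semiprime_ring R /\ left_goldie R /\ udim_eq R n /\
            card_sets_eq (@minimal_prime R) n in
  let P4 := exists S0 : R -> Prop, is_S0 S0 /\
            exists (Q : pzRingType) (f : {rmorphism R -> Q}),
              is_left_localization S0 f /\ iso_prod_division_rings Q n in
  (P1 <-> P2) /\ (P2 <-> P3) /\ (P3 <-> P4).
Proof.
move=> P1 P2 P3 P4.
pose dec := exists K : 'I_n -> R -> Prop, ore_decomposition K.
have P1_dec : P1 <-> dec.
  split=> [[R_loc R_card]|[K K_dec]]; last first.
    split; first exact: decomposition_localizable K_dec.
    exact: decomposition_card_max_left_den K_dec.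
  have [m [K K_dec]] := localizable_decomposition R_loc R_card.
  have mn : m = n.
    exact: card_sets_eq_unique (decomposition_card_max_left_den K_dec) R_card.
  by subst m; exists K.
have P3_dec : P3 <-> dec.
  split=> [[R_sp [[R_acc _] [R_udim R_min]]]|[K K_dec]].
    exact: semiprime_goldie_decomposition.
  have R_udim := decomposition_udim K_dec; split; first exact: decomposition_semiprime K_dec.
  split; first by split; [exact: decomposition_acc K_dec|exists n].
  by split=> //; exact: decomposition_card_min_primes K_dec.
have loc_dec S0 (Q : pzRingType) (f : {rmorphism R -> Q}) : subset_of S0 (@regular R) ->
    is_left_localization S0 f -> iso_prod_division_rings Q n -> dec.
  move=> S0_reg f_loc Q_prod.
  have [D [phi phiP]] := localization_embedding S0_reg f_loc Q_prod.
  by eexists; exact: embedding_decomposition phiP.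
have dec_P2 : dec -> P2.
  move=> [K /decomposition_embedding[D [phi phiP]]].
  split; first exact: embedding_left_ore phiP hn.
  exists (prod_ring D), (prod_map phi); split; first exact: embedding_localization.
  by apply: iso_prod_division_rings_prod; case: phiP.
have P2_dec : P2 <-> dec.
  by split=> // -[_ [Q [f [f_loc Q_prod]]]]; exact: loc_dec f_loc Q_prod.
have P4_dec : P4 <-> dec.
  split=> [[S0 [[_ [S0_reg _]] [Q [f [f_loc Q_prod]]]]]|/dec_P2[reg_ore loc]].
    exact: loc_dec S0_reg f_loc Q_prod.
  (* Once the regular elements form a left Ore set, they are themselves the largest such set of
     regular elements. *)
  by exists (@regular R); split=> //; split=> //; split=> // x.
by rewrite P1_dec P2_dec P3_dec P4_dec.
Qed.
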